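(* A lattice simplex $\Delta$ is (isomorphic to) a free join $\Delta_1\circ_{\mathbb{Z}}\Delta_2$ of lattice simplices $\Delta_1$ and $\Delta_2$ if and only if the corresponding linear code $C_\Delta$ is (isomorphic to) the direct sum $C_{\Delta_1}\oplus C_{\Delta_2}$.
   Context: Let $M\cong\mathbb{Z}^d$ be a lattice and $\Delta$ a $d$-dimensional lattice simplex in $M\otimes\mathbb{R}$ with vertices $v_0,\dots,v_d\in M$. Lattice simplices are isomorphic if an affine unimodular transformation maps one to the other. The free join of lattice polytopes $\Delta_1,\Delta_2$ of dimensions $d_1,d_2$ is $\Delta_1\circ_{\mathbb{Z}}\Delta_2=\operatorname{conv}(\Delta_1\times\{0^{d_2}\}\times\{0\},\ \{0^{d_1}\}\times\Delta_2\times\{1\})\subset\mathbb{R}^{d_1+d_2+1}$. Code of a simplex: $\mathbb{Z}_N=\mathbb{Z}/N\mathbb{Z}$. Let $\Lambda_\Delta=\{x\in(\mathbb{R}/\mathbb{Z})^{d+1}:\sum_i\{x_i\}(v_i,1)\in M\oplus\mathbb{Z}\}$, where $\{\cdot\}$ is the fractional part. $N_\Delta$ is the least common multiple of the denominators of all coordinates of elements of $\Lambda_\Delta$, and $C_\Delta=\{(N_\Delta\{x_0\},\dots,N_\Delta\{x_d\}):x\in\Lambda_\Delta\}\subseteq\mathbb{Z}_{N_\Delta}^{d+1}$. Codes over the same $\mathbb{Z}_N$ and of the same length are isomorphic if they coincide after a permutation of coordinates. It is known that two lattice simplices are isomorphic if and only if their codes are. Direct sum: for codes $C_1$ over $\mathbb{Z}_{N_1}$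 and $C_2$ over $\mathbb{Z}_{N_2}$, with $L=\operatorname{lcm}(N_1,N_2)$, $C_1\oplus C_2$ is the code over $\mathbb{Z}_L$ consisting of all concatenations $\frac{L}{N_1}c_1\,|\,\frac{L}{N_2}c_2$, $c_1\in C_1$, $c_2\in C_2$. *)

(* Defs.v *)
From HB Require Import structures.
From mathcomp Require Import all_boot all_order all_algebra.
From mathcomp Require Import boolp classical_sets reals convex.

Set Implicit Arguments.
Unset Strict Implicit.
Unset Printing Implicit Defensive.

Import Order.TTheory GRing.Theory Num.Theory.

Local Open Scope classical_set_scope.
Local Open Scope ring_scope.

(** The lattice is 'rV[int]_d, embedded in 'rV[R]_d by [lattice_pt]. *)

Definition lattice_pt (R : realType) d (m : 'rV[int]_d) : 'rV[R]_d :=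
  map_mx intr m.

Definition affinely_independent (R : realType) (V : lmodType R) k
    (p : 'I_k -> V) : Prop :=
  forall c : 'I_k -> R,
    \sum_i c i = 0 -> \sum_i c i *: p i = 0 -> forall i, c i = 0.

Record lattice_simplex (R : realType) d := LatticeSimplex {
  vertex : 'I_d.+1 -> 'rV[int]_d;
  vertex_indep : affinely_independent (fun i => lattice_pt R (vertex i)) }.

Definition conv_hull (R : realType) (V : lmodType R) (A : set V) : set V :=
  smallest (@convex_set R V) A.

Definition polytope (R : realType) d (D : lattice_simplex R d) :
    set 'rV[R]_d :=
  conv_hull (range (fun i => lattice_pt R (vertex D i))).

(** U and U' are mutually inverse integer matrices, so that u |-> u *m U + t
    is an affine bijection between the lattices. The ambient dimensions m and n
    are allowed to be syntactically different; U U' = 1 and U' U = 1 force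
    m = n. *)
Definition lattice_iso (R : realType) m n
    (P : set 'rV[R]_m) (Q : set 'rV[R]_n) : Prop :=
  exists (U : 'M[int]_(m, n)) (U' : 'M[int]_(n, m)) (t : 'rV[int]_n),
    [/\ U *m U' = 1%:M, U' *m U = 1%:M &
        (fun u : 'rV[R]_m => u *m map_mx intr U + lattice_pt R t) @` P = Q].

Definition free_join (R : realType) d1 d2
    (P1 : set 'rV[R]_d1) (P2 : set 'rV[R]_d2) : set 'rV[R]_(d1 + d2 + 1) :=
  conv_hull
    ((fun x : 'rV[R]_d1 => row_mx (row_mx x (0 : 'rV_d2)) (0 : 'rV_1)) @` P1 `|`
     (fun y : 'rV[R]_d2 =>
        row_mx (row_mx (0 : 'rV_d1) y) (const_mx 1 : 'rV_1)) @` P2).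

Definition frac_part (R : realType) (x : R) : R := x - (Num.floor x)%:~R.

(** An element of (R/Z)^(d+1) is given by any of its representatives in
    R^(d+1): [Lambda D] is invariant under translation by Z^(d+1). *)
Definition Lambda (R : realType) d (D : lattice_simplex R d) :
    set 'rV[R]_d.+1 :=
  [set x : 'rV[R]_d.+1 | exists m : 'rV[int]_(d + 1),
     \sum_i frac_part (x 0 i) *:
       row_mx (lattice_pt R (vertex D i)) (const_mx 1 : 'rV_1)
     = lattice_pt R m].

Definition is_denominator (R : realType) (x : R) (n : nat) : Prop :=
  exists2 q : rat, x = ratr q & n = `|denq q|%N.

(** The least upper bound of S in the divisibility order; it is 0 when S has no
    positive common multiple. *)
Definition lcm_of_set (S : set nat) : nat :=
  xget 0%N [set N | (forall n, S n -> (n %| N)%N) /\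
                    (forall N', (forall n, S n -> (n %| N')%N) -> (N %| N')%N)].

Definition simplex_modulus (R : realType) d (D : lattice_simplex R d) : nat :=
  lcm_of_set
    [set n | exists2 x, Lambda D x & exists i, is_denominator (x 0 i) n].

(** Z/NZ for N > 0, by its canonical residues 0, ..., N - 1. The library's 'Z_N
    is not used because 'Z_1 has two elements, whereas a unimodular simplex has
    N = 1. *)
Definition residue (N : nat) := 'I_N.-1.+1.

Definition code (N n : nat) := set 'rV[residue N]_n.

Definition simplex_code (R : realType) d (D : lattice_simplex R d) :
    code (simplex_modulus D) d.+1 :=
  [set c : 'rV[residue (simplex_modulus D)]_d.+1 |
     exists2 x, Lambda D x & forall i,
       (c 0 i : nat)%:R = (simplex_modulus D)%:R * frac_part (x 0 i)].
Arguments simplex_code {R d} D _.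

(** N = N' and n = n' hold only propositionally in general, so words over the
    two alphabets are compared through the natural numbers representing their
    letters. *)
Definition code_iso N n N' n' (C : code N n) (C' : code N' n') : Prop :=
  N = N' /\
  exists2 f : 'I_n -> 'I_n', bijective f &
    forall (c : 'rV[residue N]_n) (c' : 'rV[residue N']_n'),
      (forall i, c' 0 (f i) = c 0 i :> nat) -> (C c <-> C' c').

Definition scale_word N n (L : nat) (c : 'rV[residue N]_n) :
    'rV[residue L]_n :=
  map_mx (fun a : residue N => inZp (L %/ N * a)%N) c.

Definition direct_sum N1 n1 N2 n2 (C1 : code N1 n1) (C2 : code N2 n2) :
    code (lcmn N1 N2) (n1 + n2) :=
  [set c | exists c1 c2, [/\ C1 c1, C2 c2 &
     c = row_mx (scale_word (lcmn N1 N2) c1) (scale_word (lcmn N1 N2) c2)]].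

(* Main.v *)
Require Import Defs.
From mathcomp Require Import all_boot all_order all_algebra.
From mathcomp Require Import boolp classical_sets interval_inference reals convex.

Set Implicit Arguments.
Unset Strict Implicit.
Unset Printing Implicit Defensive.

Import Order.TTheory GRing.Theory Num.Theory.

Local Open Scope classical_set_scope.
Local Open Scope ring_scope.

(** To integer points p_0, ..., p_k attach the group of all x in R^(k+1) such
    that x W is integral, where the rows of W are the (p_i, 1). For the vertices
    of a simplex this group is Lambda_Delta; for the vertices of a free join,
    W is a block matrix up to a unimodular change of the last two columns, so
    the group is the product of the groups of the two factors. A code
    determines its group and conversely, and direct sums of codes correspond to
    products of groups. It remains to see that simplices are isomorphic if and
    only if their groups agree up to a permutation of coordinates: a lattice
    isomorphism permutes the vertices, hence multiplies W on the right by a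
    unimodular matrix; conversely the group is generated by the rows of the
    inverse of W, so it determines W up to such a matrix, which is affine
    because it fixes the last column of W. *)

Section ConvexCombinations.
Variables (R : realType).

Definition convex_comb (V : lmodType R) k (p : 'I_k -> V) : set V :=
  [set x | exists a : 'I_k -> R,
     [/\ forall i, 0 <= a i, \sum_i a i = 1 & x = \sum_i a i *: p i]].

Lemma convex_comb_pt (V : lmodType R) k (p : 'I_k -> V) i :
  convex_comb p (p i).
Proof.
exists (fun j => (j == i)%:R); split=> [j||]; first exact: ler0n.
- by rewrite (bigD1 i) //= eqxx big1 ?addr0 // => j /negPf->.
- by rewrite (bigD1 i) //= eqxx scale1r big1 ?addr0 // => j /negPf->;
    rewrite scale0r.
Qed.

Lemma conv_lmodE (V : lmodType R) (t : {i01 R}) (x y : convex_lmodType V) :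
  conv t x y = t%:num *: (x : V) + (1 - t%:num) *: (y : V) :> V.
Proof. by []. Qed.

Lemma convex_comb_convex (V : lmodType R) k (p : 'I_k -> V) :
  convex_set (convex_comb p).
Proof.
move=> _ _ t /set_mem [a [a0 a1 ->]] /set_mem [b [b0 b1 ->]]; apply: mem_set.
exists (fun i => t%:num * a i + (1 - t%:num) * b i); split=> [i||].
- by rewrite addr_ge0 // mulr_ge0 // subr_ge0.
- by rewrite big_split /= -!mulr_sumr a1 b1 !mulr1 addrC subrK.
- rewrite conv_lmodE !scaler_sumr -big_split; apply: eq_bigr => i _ /=.
  by rewrite !scalerA -scalerDl.
Qed.

Lemma convex_set_comb (V : lmodType R) k (p : 'I_k -> V) (A : set V) :
  convex_set A -> (forall i, A (p i)) -> convex_comb p `<=` A.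
Proof.
move=> cA; elim: k p => [|k IHk] p Ap _ [a [a_ge0 a_sum ->]].
  by move: a_sum; rewrite big_ord0 => /eqP; rewrite eq_sym oner_eq0.
rewrite big_ord_recl; pose b (i : 'I_k) := a (lift ord0 i).
have bE : \sum_i b i = 1 - a ord0 by rewrite -a_sum big_ord_recl addrC addKr.
have b_ge0 : 0 <= 1 - a ord0 by rewrite -bE; apply: sumr_ge0 => i _; apply: a_ge0.
have [t0|tN0] := eqVneq (1 - a ord0) 0.
  rewrite big1 ?addr0 => [|i _].
    by move/eqP: t0; rewrite subr_eq0 => /eqP <-; rewrite scale1r.
  rewrite (_ : a _ = 0) ?scale0r //; apply/eqP; rewrite eq_le a_ge0 andbT.
  by rewrite -t0 -bE (bigD1 i) //= lerDl; apply: sumr_ge0 => j _; apply: a_ge0.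
have Aq : A (\sum_i (b i / (1 - a ord0)) *: p (lift ord0 i)).
  apply: (IHk (fun i => p (lift ord0 i))) => // .
  exists (fun i => b i / (1 - a ord0)); split=> // [i|].
    by rewrite divr_ge0 ?a_ge0.
  by rewrite -mulr_suml bE divff.
have a_le1 : a ord0 <= 1 by rewrite -subr_ge0.
have /set_mem := cA _ _ (Itv01 (a_ge0 ord0) a_le1)
  (mem_set (Ap ord0)) (mem_set Aq).
rewrite conv_lmodE scaler_sumr /=.
under eq_bigr do rewrite scalerA mulrCA divff // mulr1.
by [].
Qed.

Lemma conv_hull_min (V : lmodType R) (A B : set V) :
  convex_set B -> A `<=` B -> conv_hull A `<=` B.
Proof. by move=> cB AB; apply: smallest_sub. Qed.

Lemma conv_hull_range (V : lmodType R) k (p : 'I_k -> V) :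
  conv_hull (range p) = convex_comb p.
Proof.
rewrite eqEsubset; split.
  apply: conv_hull_min; first exact: convex_comb_convex.
  by move=> _ [i _ <-]; apply: convex_comb_pt.
by move=> x px A [cA pA]; apply: (convex_set_comb cA _ px) => i; apply: pA.
Qed.

Lemma convex_comb_affine_image (V W : lmodType R) k (p : 'I_k -> V)
    (f : {linear V -> W}) (t : W) :
  (fun x => f x + t) @` convex_comb p = convex_comb (fun i => f (p i) + t).
Proof.
have fE (a : 'I_k -> R) : \sum_i a i = 1 ->
    f (\sum_i a i *: p i) + t = \sum_i a i *: (f (p i) + t).
  move=> a1; under [RHS]eq_bigr do rewrite scalerDr.
  rewrite big_split /= -scaler_suml a1 scale1r linear_sum.
  by congr (_ + _); apply: eq_bigr => i _; rewrite linearZ.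
rewrite eqEsubset; split=> [_ [_ [a [a0 a1 ->]] <-]|_ [a [a0 a1 ->]]].
  by exists a; split=> //; apply: fE.
by exists (\sum_i a i *: p i); [exists a | apply: fE].
Qed.

Lemma affinely_independent_inj (V : lmodType R) k (p : 'I_k -> V)
    (a b : 'I_k -> R) :
  affinely_independent p -> \sum_i a i = \sum_i b i ->
  \sum_i a i *: p i = \sum_i b i *: p i -> a =1 b.
Proof.
move=> ip ab abp i; apply/eqP; rewrite -subr_eq0; apply/eqP.
apply: (ip (fun i => a i - b i)).
  by rewrite sumrB ab subrr.
by under eq_bigr do rewrite scalerBl; rewrite sumrB abp subrr.
Qed.

Lemma affinely_independent_affine (V W : lmodType R) k (p : 'I_k -> V)
    (f : {linear V -> W}) (t : W) :
  injective f -> affinely_independent p ->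
  affinely_independent (fun i => f (p i) + t).
Proof.
move=> finj ip c c0 cp; apply: ip => //; apply: finj; rewrite linear0 -{}cp.
under [RHS]eq_bigr do rewrite scalerDr.
rewrite big_split /= -scaler_suml c0 scale0r addr0 linear_sum.
by apply: eq_bigr => i _; rewrite linearZ.
Qed.

(* If p = A q and q = B p with A, B stochastic, then B A = 1; as B >= 0, the
   support of row j of B picks out rows of A that are unit vectors. *)
Lemma convex_comb_vertex (V : lmodType R) k l (p : 'I_k -> V) (q : 'I_l -> V) :
  affinely_independent q -> convex_comb p = convex_comb q ->
  forall j, exists i, p i = q j.
Proof.
move=> iq pq j.
have /choice[a Ha] : forall i, exists a : 'I_l -> R,
    [/\ forall i, 0 <= a i, \sum_i a i = 1 & p i = \sum_i a i *: q i].
  by move=> i; have := convex_comb_pt p i; rewrite pq.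
have [b [b0 b1 qE]] : convex_comb p (q j).
  by rewrite pq; apply: convex_comb_pt.
have [i bi] : exists i, b i != 0.
  apply/not_existsP => b_0; move/eqP: b1; rewrite big1 ?(eq_sym 0) ?oner_eq0 //.
  by move=> i _; apply/eqP; apply: contrapT => /negP; apply: b_0.
have ba : (fun m => \sum_i b i * a i m) =1 (fun m => (m == j)%:R).
  apply: (affinely_independent_inj iq).
    rewrite exchange_big /= [RHS](bigD1 j) //= eqxx [X in _ + X]big1 ?addr0.
      rewrite -b1; apply: eq_bigr => m _; rewrite -mulr_sumr.
      by have [_ -> _] := Ha m; rewrite mulr1.
    by move=> m /negPf->.
  rewrite [RHS](bigD1 j) //= eqxx scale1r [X in _ + X]big1 ?addr0.
    under eq_bigr do rewrite scaler_suml; rewrite exchange_big /= qE.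
    apply: eq_bigr => m _; have [_ _ ->] := Ha m; rewrite scaler_sumr.
    by apply: eq_bigr => n _; rewrite scalerA.
  by move=> m /negPf->; rewrite scale0r.
have [a0 a1 pE] := Ha i.
have a_0 m : m != j -> a i m = 0.
  move=> mj; have := ba m; rewrite (negPf mj) => /eqP.
  rewrite psumr_eq0 => [|n _]; last by have [an _ _] := Ha n; rewrite mulr_ge0.
  by move/allP/(_ i); rewrite mem_index_enum mulf_eq0 (negPf bi) => /(_ isT)/eqP.
exists i; rewrite pE (bigD1 j) //= big1 ?addr0 => [|m /a_0->]; last first.
  by rewrite scale0r.
by move: a1; rewrite (bigD1 j) //= big1 ?addr0 => [->|//]; rewrite scale1r.
Qed.

Lemma affinely_independent_pt_inj (V : lmodType R) k (p : 'I_k -> V) :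
  affinely_independent p -> injective p.
Proof.
move=> ip i j pij; apply/eqP.
have ptE (g : 'I_k -> V) m : \sum_i (i == m)%:R *: g i = g m.
  by rewrite (bigD1 m) //= eqxx scale1r big1 ?addr0 // => n /negPf->;
    rewrite scale0r.
have ptS m : \sum_i (i == m)%:R = 1 :> R.
  by rewrite (bigD1 m) //= eqxx big1 ?addr0 // => n /negPf->.
have : (fun n => (n == i)%:R : R) =1 (fun n => (n == j)%:R).
  by apply: (affinely_independent_inj ip); rewrite ?ptS ?ptE.
by move/(_ i); rewrite eqxx; case: (i == j) => // /eqP; rewrite oner_eq0.
Qed.

Lemma convex_comb_bij (V : lmodType R) k l (p : 'I_k -> V) (q : 'I_l -> V) :
  affinely_independent p -> affinely_independent q ->
  convex_comb p = convex_comb q ->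
  exists2 f : 'I_k -> 'I_l, bijective f & forall i, q (f i) = p i.
Proof.
move=> ip iq pq.
have /choice[f fE] := convex_comb_vertex ip (esym pq).
have /choice[g gE] := convex_comb_vertex iq pq.
exists f => //; exists g => i.
- by apply: (affinely_independent_pt_inj ip); rewrite gE fE.
- by apply: (affinely_independent_pt_inj iq); rewrite fE gE.
Qed.

End ConvexCombinations.

Section DualGroup.
Variables (R : realType).

Lemma lattice_pt_int m (v : 'rV[int]_m) :
  lattice_pt R v \is a mxOver Num.int.
Proof. by apply/mxOverP => i j; rewrite mxE intr_int. Qed.

Lemma mxOver_intP m n (A : 'M[R]_(m, n)) :
  A \is a mxOver Num.int -> exists B : 'M[int]_(m, n), A = map_mx intr B.
Proof.
move=> /mxOverP Aint; exists (map_mx Num.floor A).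
by apply/matrixP => i j; rewrite !mxE floorK.
Qed.

Lemma mxOver_int_row_mx m n1 n2 (A : 'M[R]_(m, n1)) (B : 'M[R]_(m, n2)) :
  row_mx A B \is a mxOver Num.int <->
  A \is a mxOver Num.int /\ B \is a mxOver Num.int.
Proof.
split=> [/mxOverP AB|[/mxOverP Ai /mxOverP Bi]].
  split; apply/mxOverP => i j.
    by have := AB i (lshift _ j); rewrite row_mxEl.
  by have := AB i (rshift _ j); rewrite row_mxEr.
apply/mxOverP => i j; case: (split_ordP j) => {}j ->.
  by rewrite row_mxEl.
by rewrite row_mxEr.
Qed.

Lemma map_intr_inj m n : injective (map_mx intr : 'M[int]_(m, n) -> 'M[R]_(m, n)).
Proof.
move=> A B /matrixP AB; apply/matrixP => i j.
by have /eqP := AB i j; rewrite !mxE eqr_int => /eqP.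
Qed.

Definition homogenization k m (p : 'I_k -> 'rV[int]_m) : 'M[R]_(k, m + 1) :=
  \matrix_i row_mx (lattice_pt R (p i)) (const_mx 1).

(* [dual_group p] is dual to the lattice spanned by the columns of
   [homogenization p]. *)
Definition dual_group k m (p : 'I_k -> 'rV[int]_m) : set 'rV[R]_k :=
  [set x | x *m homogenization p \is a mxOver Num.int].

Lemma homogenization_int k m (p : 'I_k -> 'rV[int]_m) :
  homogenization p \is a mxOver Num.int.
Proof.
apply/mxOverP => i j; rewrite mxE; case: (split_ordP j) => {}j ->.
  by rewrite row_mxEl mxE intr_int.
by rewrite row_mxEr mxE.
Qed.

Lemma mul_homogenization k m (p : 'I_k -> 'rV[int]_m) (x : 'rV[R]_k) :
  x *m homogenization p =
  row_mx (\sum_i x 0 i *: lattice_pt R (p i)) (const_mx (\sum_i x 0 i)).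
Proof.
rewrite mulmx_sum_row; apply/rowP => j; case: (split_ordP j) => {}j ->.
  rewrite row_mxEl !summxE; apply: eq_bigr => i _.
  by rewrite rowK mxE row_mxEl [RHS]mxE.
rewrite row_mxEr !summxE mxE; apply: eq_bigr => i _.
by rewrite rowK mxE row_mxEr mxE mulr1.
Qed.

Lemma homogenization_free k m (p : 'I_k -> 'rV[int]_m) :
  affinely_independent (fun i => lattice_pt R (p i)) ->
  row_free (homogenization p).
Proof.
move=> ip; apply: inj_row_free => x; rewrite mul_homogenization -row_mx0.
move=> /eq_row_mx[xp /rowP/(_ 0)]; rewrite !mxE => x0.
by apply/rowP => i; rewrite mxE; apply: ip x0 xp i.
Qed.

Lemma homogenization_full k m (p : 'I_k -> 'rV[int]_m) :
  k = (m + 1)%N -> affinely_independent (fun i => lattice_pt R (p i)) ->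
  row_full (homogenization p).
Proof.
by move=> km /homogenization_free /eqP rkp; apply/eqP; rewrite rkp.
Qed.

Lemma dual_groupD k m (p : 'I_k -> 'rV[int]_m) (x y : 'rV[R]_k) :
  x \is a mxOver Num.int -> (dual_group p (x + y) <-> dual_group p y).
Proof.
move=> xi; rewrite /dual_group /= mulmxDl.
have := mxOverM xi (homogenization_int p); move: (x *m _) (y *m _) => X Y.
move=> /mxOverP XI; split=> /mxOverP YI; apply/mxOverP => i j; last first.
  by rewrite mxE rpredD.
by have := rpredB (YI i j) (XI i j); rewrite mxE [X in X - _]addrC addrK.
Qed.

Definition frac_row k (x : 'rV[R]_k) : 'rV[R]_k := map_mx (@frac_part R) x.

Lemma frac_rowE k (x : 'rV[R]_k) :
  x = map_mx intr (map_mx Num.floor x) + frac_row x.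
Proof. by apply/rowP => i; rewrite !mxE addrC subrK. Qed.

Lemma dual_group_frac k m (p : 'I_k -> 'rV[int]_m) (x : 'rV[R]_k) :
  dual_group p (frac_row x) <-> dual_group p x.
Proof.
rewrite [X in _ <-> _ X]frac_rowE dual_groupD //.
by apply/mxOverP => i j; rewrite mxE intr_int.
Qed.

Lemma dual_group0 k m (p : 'I_k -> 'rV[int]_m) : dual_group p 0.
Proof. by rewrite /dual_group /= mul0mx mxOver0. Qed.

Lemma Lambda_dual_group d (D : lattice_simplex R d) :
  Lambda D = dual_group (vertex D).
Proof.
rewrite eqEsubset; split=> x; rewrite -/(dual_group _ x) => Lx.
  apply/dual_group_frac; rewrite /dual_group /= mulmx_sum_row.
  case: Lx => m xm; suff -> : \sum_i frac_row x 0 i *: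
      row i (homogenization (vertex D)) = lattice_pt R m by exact: lattice_pt_int.
  by rewrite -xm; apply: eq_bigr => i _; rewrite rowK !mxE.
move/dual_group_frac: Lx; rewrite /dual_group /= mulmx_sum_row => /mxOver_intP[m].
by move=> xm; exists m; rewrite -[RHS]xm; apply: eq_bigr => i _; rewrite rowK mxE.
Qed.

Lemma dual_group_reindex k k' m (p : 'I_k -> 'rV[int]_m) (f : 'I_k' -> 'I_k)
    (x : 'rV[R]_k) :
  bijective f ->
  dual_group (p \o f) (colsub f x) <-> dual_group p x.
Proof.
move=> fbij; rewrite /dual_group /= !mul_homogenization.
set L := row_mx _ _; set L' := row_mx _ _; suff -> : L = L' by [].
congr (row_mx _ (const_mx _)).
  rewrite [RHS](reindex f) /=; last exact: onW_bij.
  by apply: eq_bigr => i _; rewrite mxE.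
rewrite [RHS](reindex f) /=; last exact: onW_bij.
by apply: eq_bigr => i _; rewrite mxE.
Qed.

Lemma dual_group_affine k m n (p : 'I_k -> 'rV[int]_m) (q : 'I_k -> 'rV[int]_n)
    (U : 'M[int]_(m, n)) (t : 'rV[int]_n) :
  (forall i, q i = p i *m U + t) -> dual_group p `<=` dual_group q.
Proof.
move=> qE x; rewrite /dual_group /= => px.
have -> : homogenization q = homogenization p *m
    block_mx (map_mx intr U) 0 (lattice_pt R t) 1%:M.
  apply/row_matrixP => i; rewrite row_mul !rowK mul_row_block !mulmx0 add0r mulmx1.
  congr row_mx; rewrite qE /lattice_pt map_mxD map_mxM; congr (_ + _).
  by rewrite (_ : const_mx 1 = 1%:M) ?mul1mx //; apply/rowP => j; rewrite !mxE !ord1.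
rewrite mulmxA mxOverM //; apply/mxOverP => i j.
case: (split_ordP i) => {}i ->; case: (split_ordP j) => {}j ->.
- by rewrite block_mxEul mxE intr_int.
- by rewrite block_mxEur mxE rpred0.
- by rewrite block_mxEdl mxE intr_int.
- by rewrite block_mxEdr mxE rpredMn ?rpred1.
Qed.

(* The inverse of a homogenization has rows in the dual group, so equality of
   the dual groups makes the base change between the two homogenizations and its
   inverse integral. *)
Lemma dual_group_eq_affine k m n (p : 'I_k -> 'rV[int]_m) (q : 'I_k -> 'rV[int]_n) :
  row_free (homogenization p) -> row_full (homogenization p) ->
  row_free (homogenization q) -> row_full (homogenization q) ->
  dual_group p = dual_group q ->
  exists (U : 'M[int]_(m, n)) (U' : 'M[int]_(n, m)) (t : 'rV[int]_n),
    [/\ U *m U' = 1%:M, U' *m U = 1%:M & forall i, q i = p i *m U + t].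
Proof.
set P := homogenization p; set Q := homogenization q => freeP fullP freeQ fullQ pq.
have base_change l (r : 'I_k -> 'rV[int]_l) l' (s : 'I_k -> 'rV[int]_l') :
    row_full (homogenization r) -> dual_group r = dual_group s ->
    exists A : 'M[int]_(l + 1, l' + 1),
      pinvmx (homogenization r) *m homogenization s = map_mx intr A.
  move=> fullr rs; apply: mxOver_intP; apply/mxOverP => i j.
  have : dual_group r (row i (pinvmx (homogenization r))).
    rewrite /dual_group /= -row_mul mulVpmx // row1.
    by apply/mxOverP => i' j'; rewrite mxE; case: (_ && _); rewrite ?rpred1 ?rpred0.
  by rewrite rs /dual_group /= -row_mul => /mxOverP/(_ 0 j); rewrite mxE.
have [A AE] := base_change _ _ _ _ fullP pq.
have [B BE] := base_change _ _ _ _ fullQ (esym pq).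
have QE : Q = P *m map_mx intr A by rewrite -AE mulmxA mulmxVp // mul1mx.
have one_col l (r : 'I_k -> 'rV[int]_l) :
    homogenization r *m col_mx 0 1 = const_mx 1 :> 'cV[R]_k.
  apply/colP => i; rewrite mxE [RHS]mxE big_split_ord /= big1 ?add0r => [|j _].
    by rewrite big_ord1 mxE row_mxEr col_mxEd !mxE mulr1.
  by rewrite col_mxEu [X in _ * X]mxE mulr0.
have col_last l (r : 'I_k -> 'rV[int]_l) l' (s : 'I_k -> 'rV[int]_l')
    (C : 'M[int]_(l + 1, l' + 1)) : row_full (homogenization r) ->
    pinvmx (homogenization r) *m homogenization s = map_mx intr C ->
    ursubmx C = 0 /\ drsubmx C = 1.
  move=> fullr CE; have : map_mx intr C *m col_mx 0 1 = col_mx 0 1 :> 'cV[R]_(l + 1).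
    by rewrite -CE -mulmxA one_col -(one_col _ r) mulmxA mulVpmx // mul1mx.
  rewrite -{1}[C]submxK map_block_mx mul_block_col !mulmx0 !add0r !mulmx1.
  move=> /eq_col_mx[Cu Cd]; split; apply: (@map_intr_inj _ _).
    by rewrite Cu map_mx0.
  by rewrite Cd map_mx1.
have [Aur Adr] := col_last _ _ _ _ _ fullP AE.
have [Bur Bdr] := col_last _ _ _ _ _ fullQ BE.
have AB1 : A *m B = 1%:M.
  apply: map_intr_inj; rewrite map_mxM map_mx1 -AE -BE -mulmxA [Q *m _]mulmxA.
  by rewrite mulmxVp // mul1mx mulVpmx.
have BA1 : B *m A = 1%:M.
  apply: map_intr_inj; rewrite map_mxM map_mx1 -AE -BE -mulmxA [P *m _]mulmxA.
  by rewrite mulmxVp // mul1mx mulVpmx.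
exists (ulsubmx A), (ulsubmx B), (dlsubmx A); split.
- move: AB1; rewrite -{1}[A]submxK -{1}[B]submxK Aur Bur mulmx_block mul0mx addr0.
  by rewrite -[RHS]submxK => /eq_block_mx[-> _ _ _]; apply/matrixP => i j;
    rewrite !mxE (inj_eq (@lshift_inj _ _)).
- move: BA1; rewrite -{1}[A]submxK -{1}[B]submxK Aur Bur mulmx_block mul0mx addr0.
  by rewrite -[RHS]submxK => /eq_block_mx[-> _ _ _]; apply/matrixP => i j;
    rewrite !mxE (inj_eq (@lshift_inj _ _)).
move=> i; apply: map_intr_inj; move/row_matrixP/(_ i): QE; rewrite row_mul !rowK.
rewrite -{1}[A]submxK map_block_mx mul_row_block => /eq_row_mx[qE _].
apply: (etrans qE); rewrite map_mxD map_mxM; congr (_ + _).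
by rewrite (_ : const_mx 1 = 1%:M) ?mul1mx //; apply/rowP => j; rewrite !mxE !ord1.
Qed.

End DualGroup.

Section Codes.
Variables (R : realType).

Lemma dvdn_denq (q : rat) (N : nat) :
  (`|denq q| %| N)%N = (N%:R * ratr q \is a @Num.int R).
Proof.
apply/idP/intrP => [/dvdnP[k ->]|[z Nq]].
  exists (k%:Z * numq q); rewrite natrM -mulrA intrM; congr (_ * _).
  rewrite natr_absz gtr0_norm ?denq_gt0 // /ratr mulrC divfK //.
  by rewrite intr_eq0 denq_neq0.
have {}Nq : N%:Z * numq q = z * denq q.
  apply/eqP; rewrite -(eqr_int R) !intrM -Nq /ratr -pmulrn -mulrA; apply/eqP.
  by congr (_ * _); rewrite divfK // intr_eq0 denq_neq0.
have := congr1 absz Nq; rewrite !abszM /= => Nq'.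
have : (`|denq q| %| N * `|numq q|)%N by rewrite Nq' dvdn_mull.
by rewrite Gauss_dvdl // coprime_sym coprime_num_den.
Qed.

Lemma rational_dual_group k m (p : 'I_k -> 'rV[int]_m) :
  affinely_independent (fun i => lattice_pt R (p i)) ->
  exists V : 'M[rat]_(m + 1, k), forall x : 'rV[R]_k, dual_group p x ->
    exists z : 'rV[int]_(m + 1), x = map_mx ratr (map_mx intr z *m V).
Proof.
move=> ip; have [Z ZE] := mxOver_intP (homogenization_int R p).
exists (pinvmx (map_mx intr Z)) => x /mxOver_intP[z zE].
have ratr_intr n n' (B : 'M[int]_(n, n')) :
    map_mx ratr (map_mx intr B : 'M[rat]_(n, n')) = map_mx intr B :> 'M[R]_(n, n').
  by apply/matrixP => i j; rewrite !mxE ratr_int.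
exists z; rewrite map_mxM map_pinvmx !ratr_intr -zE -ZE -mulmxA.
by rewrite mulmxVp ?mulmx1 //; apply: homogenization_free.
Qed.

Lemma dual_group_exponent k m (p : 'I_k -> 'rV[int]_m) :
  affinely_independent (fun i => lattice_pt R (p i)) ->
  exists2 M, (0 < M)%N & forall x : 'rV[R]_k, dual_group p x ->
    M%:R *: x \is a mxOver Num.int.
Proof.
move=> /rational_dual_group[V VE].
exists (\prod_(ij : 'I_(m + 1) * 'I_k) `|denq (V ij.1 ij.2)|)%N.
  by rewrite prodn_gt0 // => ij; rewrite absz_gt0 denq_neq0.
move=> x /VE[z ->]; rewrite map_mxM scalemxAr; apply: mxOverM.
  by apply/mxOverP => i j; rewrite !mxE rmorph_int intr_int.
by apply/mxOverP => i j; rewrite !mxE /= -dvdn_denq (bigD1 (i, j)) //= dvdn_mulr.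
Qed.

Lemma lcm_of_setP (S : set nat) M :
  (0 < M)%N -> (forall n, S n -> (n %| M)%N) ->
  forall N', (lcm_of_set S %| N')%N <-> forall n, S n -> (n %| N')%N.
Proof.
move=> M_gt0 SM.
pose L := (\big[lcmn/1]_(n < M.+1 | `[< S n >]) n)%N.
have LP N' : (L %| N')%N <-> forall n, S n -> (n %| N')%N.
  split=> [/dvdn_biglcmP LN' n Sn|SN'].
    have nM : (n < M.+1)%N by rewrite ltnS dvdn_leq // SM.
    by apply: (LN' (Ordinal nM)); apply/asboolP.
  by apply/dvdn_biglcmP => n /asboolP; apply: SN'.
have [SN Nmin] := xgetPex 0%N (ex_intro
  [set N | (forall n, S n -> (n %| N)%N) /\
           (forall N', (forall n, S n -> (n %| N')%N) -> (N %| N')%N)]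
  L (conj ((LP L).1 (dvdnn L)) (fun N' => (LP N').2))).
move=> N'; split=> [NN' n Sn|]; last exact: Nmin.
exact: dvdn_trans (SN n Sn) NN'.
Qed.

Definition word_pt N n (c : 'rV[residue N]_n) : 'rV[R]_n :=
  \row_i ((c 0 i : nat)%:R / N%:R).

Lemma ltn_residue N (a : residue N) : (0 < N)%N -> (a < N)%N.
Proof. by move=> /prednK {2}<-. Qed.

Lemma frac_part_ge0 (x : R) : 0 <= frac_part x.
Proof. by rewrite subr_ge0 floor_le. Qed.

Lemma frac_part_lt1 (x : R) : frac_part x < 1.
Proof. by have := floorD1_gt x; rewrite intrD ltrBlDl. Qed.

Lemma frac_part_id (x : R) : 0 <= x < 1 -> frac_part x = x.
Proof.
by move=> x01; rewrite /frac_part (@floor_def _ _ 0) ?subr0.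
Qed.

Lemma frac_word_pt N n (c : 'rV[residue N]_n) :
  (0 < N)%N -> frac_row (word_pt c) = word_pt c.
Proof.
move=> N_gt0; apply/rowP => i; rewrite !mxE frac_part_id //.
by rewrite divr_ge0 //= ltr_pdivrMr ?ltr0n // mul1r ltr_nat ltn_residue.
Qed.

Lemma word_pt_inj N n : (0 < N)%N -> injective (@word_pt N n).
Proof.
move=> N_gt0 c c' /rowP cc'; apply/rowP => i; apply/val_inj/eqP => /=.
have N_neq0 : N%:R != 0 :> R by rewrite pnatr_eq0 -lt0n.
by have /eqP := cc' i; rewrite !mxE (inj_eq (divIf N_neq0)) eqr_nat.
Qed.

Lemma word_pt_surj N n (x : 'rV[R]_n) :
  (0 < N)%N -> N%:R *: x \is a mxOver Num.int ->
  exists c : 'rV[residue N]_n, word_pt c = frac_row x.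
Proof.
move=> N_gt0 /mxOverP Nx.
have /choice[a aE] i : exists a : nat, a%:R = N%:R * frac_part (x 0 i).
  have : N%:R * frac_part (x 0 i) \is a Num.nat.
    rewrite natrEint mulr_ge0 ?frac_part_ge0 // andbT /frac_part mulrBr.
    by have := Nx 0 i; rewrite mxE => ?; rewrite rpredB // rpredM ?rpred_nat ?intr_int.
  by move/natrP=> [a ->]; exists a.
have N0 : (0 : R) < N%:R by rewrite ltr0n.
have aN i : (a i < N.-1.+1)%N.
  by rewrite prednK // -(ltr_nat R) aE gtr_pMr // frac_part_lt1.
exists (\row_i Ordinal (aN i)); apply/rowP => i.
by rewrite !mxE /= aE mulrAC divff ?mul1r // gt_eqF.
Qed.

(* [code_of C G]: C is the code obtained from the subgroup G of R^n, which
   contains Z^n, by the same recipe that defines C_Delta from Lambda_Delta. *)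
Record code_of N n (C : code N n) (G : set 'rV[R]_n) : Prop := CodeOf {
  code_of_dvd : forall N', (N %| N')%N <->
    forall x, G x -> N'%:R *: x \is a mxOver Num.int;
  code_of_gt0 : (0 < N)%N;
  code_of_0 : G 0;
  code_of_frac : forall x, G (frac_row x) <-> G x;
  code_of_word : forall c, C c <-> G (word_pt c) }.

Lemma code_of_int N n (C : code N n) (G : set 'rV[R]_n) x :
  code_of C G -> G x -> N%:R *: x \is a mxOver Num.int.
Proof. by move=> CG; apply: (code_of_dvd CG N).1. Qed.

Lemma simplex_code_of d (D : lattice_simplex R d) :
  code_of (simplex_code D) (dual_group (vertex D)).
Proof.
have [M M_gt0 MP] := dual_group_exponent (@vertex_indep R d D).
have [V VP] := rational_dual_group (@vertex_indep R d D).
pose S := [set n | exists2 x, Lambda D x & exists i, is_denominator (x 0 i) n].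
have SP N' : (forall n, S n -> (n %| N')%N) <->
    forall x : 'rV[R]_d.+1, dual_group (vertex D) x -> N'%:R *: x \is a mxOver Num.int.
  rewrite -Lambda_dual_group; split=> [SN' x Dx|N'x n [x Dx [i [q xq ->]]]].
    apply/mxOverP => j i; rewrite ord1 mxE.
    have [z xE] := VP x (eq_ind _ (fun A => A x) Dx _ (Lambda_dual_group D)).
    rewrite xE mxE -dvdn_denq; apply: SN'; exists x => //; exists i.
    by exists ((map_mx intr z *m V) 0 i); rewrite // xE mxE.
  by have /mxOverP/(_ 0 i) := N'x x Dx; rewrite mxE xq -dvdn_denq.
have dvdP N' : (simplex_modulus D %| N')%N <->
    forall x : 'rV[R]_d.+1, dual_group (vertex D) x -> N'%:R *: x \is a mxOver Num.int.
  by rewrite -SP; apply: (lcm_of_setP M_gt0); apply/SP.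
have N_gt0 : (0 < simplex_modulus D)%N.
  by apply: (@dvdn_gt0 _ M) => //; apply/dvdP.
split=> // [|x|c]; [exact: dual_group0|exact: dual_group_frac|].
have N_neq0 : (simplex_modulus D)%:R != 0 :> R by rewrite pnatr_eq0 -lt0n.
rewrite -Lambda_dual_group; split=> [[x Dx cE]|Dc].
  suff -> : word_pt c = frac_row x.
    by move: Dx; rewrite Lambda_dual_group => /dual_group_frac.
  by apply/rowP => i; rewrite !mxE cE mulrAC divff ?mul1r.
exists (word_pt c) => // i; have /rowP/(_ i) := frac_word_pt c N_gt0.
by rewrite !mxE => ->; rewrite mulrC divfK.
Qed.

Lemma word_pt_scale N n L (c : 'rV[residue N]_n) :
  (0 < L)%N -> (N %| L)%N -> word_pt (scale_word L c) = word_pt c.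
Proof.
move=> L_gt0 NL; have N_gt0 := dvdn_gt0 L_gt0 NL.
have q_gt0 : (0 < L %/ N)%N by rewrite divn_gt0 // dvdn_leq.
apply/rowP => i; rewrite !mxE /= modn_small; last first.
  by rewrite (prednK L_gt0) -[ltnRHS](divnK NL) ltn_pmul2l // ltn_residue.
have -> : L%:R = (L %/ N)%:R * N%:R :> R by rewrite -natrM divnK.
by rewrite natrM invfM mulrACA divff ?mul1r // pnatr_eq0 -lt0n.
Qed.

Lemma word_pt_row_mx N n1 n2 (c1 : 'rV[residue N]_n1) (c2 : 'rV[residue N]_n2) :
  word_pt (row_mx c1 c2) = row_mx (word_pt c1) (word_pt c2).
Proof.
apply/rowP => i; case: (split_ordP i) => {}i ->.
  by rewrite row_mxEl mxE row_mxEl mxE.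
by rewrite row_mxEr mxE row_mxEr mxE.
Qed.

Definition group_prod n1 n2 (G1 : set 'rV[R]_n1) (G2 : set 'rV[R]_n2) :
    set 'rV[R]_(n1 + n2) :=
  [set x | G1 (lsubmx x) /\ G2 (rsubmx x)].

Lemma direct_sum_code_of N1 n1 N2 n2 (C1 : code N1 n1) (C2 : code N2 n2)
    (G1 : set 'rV[R]_n1) (G2 : set 'rV[R]_n2) :
  code_of C1 G1 -> code_of C2 G2 -> code_of (direct_sum C1 C2) (group_prod G1 G2).
Proof.
move=> CG1 CG2.
have L_gt0 : (0 < lcmn N1 N2)%N.
  by rewrite lcmn_gt0 (code_of_gt0 CG1) (code_of_gt0 CG2).
split=> // [N'||x|c].
- rewrite dvdn_lcm; split=> [/andP[N1' N2'] x [G1x G2x]|N'x].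
    rewrite -[x]hsubmxK scale_row_mx; apply/mxOver_int_row_mx; split.
      exact: (code_of_dvd CG1 N').1 G1x.
    exact: (code_of_dvd CG2 N').1 G2x.
  apply/andP; split; [apply/(code_of_dvd CG1)|apply/(code_of_dvd CG2)] => x Gx.
    have := N'x (row_mx x 0); rewrite scale_row_mx mxOver_int_row_mx.
    rewrite /group_prod /= row_mxKl row_mxKr.
    by move=> /(_ (conj Gx (code_of_0 CG2)))[].
  have := N'x (row_mx 0 x); rewrite scale_row_mx mxOver_int_row_mx.
  rewrite /group_prod /= row_mxKl row_mxKr.
  by move=> /(_ (conj (code_of_0 CG1) Gx))[].
- by split; rewrite linear0; [apply: code_of_0 CG1 | apply: code_of_0 CG2].
- rewrite /group_prod /= /frac_row -map_lsubmx -map_rsubmx.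
  split=> -[xl xr]; split.
  + exact/(code_of_frac CG1).
  + exact/(code_of_frac CG2).
  + exact/(code_of_frac CG1).
  + exact/(code_of_frac CG2).
have N1L := dvdn_lcml N1 N2; have N2L := dvdn_lcmr N1 N2.
split=> [[c1 [c2 [/(code_of_word CG1) Gc1 /(code_of_word CG2) Gc2 ->]]]|].
  rewrite /group_prod /= word_pt_row_mx !word_pt_scale //.
  by rewrite row_mxKl row_mxKr.
rewrite -[c]hsubmxK word_pt_row_mx /group_prod /= row_mxKl row_mxKr => -[Gl Gr].
have [c1 c1E] := word_pt_surj (code_of_gt0 CG1) (code_of_int CG1 Gl).
have [c2 c2E] := word_pt_surj (code_of_gt0 CG2) (code_of_int CG2 Gr).
rewrite frac_word_pt // in c1E; rewrite frac_word_pt // in c2E.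
exists c1, c2; split.
- by apply/(code_of_word CG1); rewrite c1E.
- by apply/(code_of_word CG2); rewrite c2E.
- by congr row_mx; apply: (word_pt_inj L_gt0); rewrite word_pt_scale.
Qed.

Lemma code_iso_groups N n N' n' (C : code N n) (C' : code N' n')
    (G : set 'rV[R]_n) (G' : set 'rV[R]_n') :
  code_of C G -> code_of C' G' ->
  code_iso C C' <->
  exists2 f : 'I_n -> 'I_n', bijective f & forall y, G (colsub f y) <-> G' y.
Proof.
move=> CG CG'; split=> [[NN' [f fbij fP]]|[f fbij fP]].
  subst N'; exists f => // y; have N_gt0 := code_of_gt0 CG.
  have [g fK gK] := fbij.
  have words (c : 'rV[residue N]_n) (c' : 'rV[residue N]_n') :
      word_pt c' = frac_row y -> word_pt c = frac_row (colsub f y) -> C c <-> C' c'.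
    move=> c'E cE; apply: fP => i; congr nat_of_ord.
    suff -> : c = colsub f c' by rewrite mxE.
    apply: (word_pt_inj N_gt0); rewrite cE; apply/rowP => j.
    by move/rowP/(_ (f j)): c'E; rewrite !mxE => <-.
  have G_iff : N%:R *: y \is a mxOver Num.int -> G (colsub f y) <-> G' y.
    move=> Ny; have Nfy : N%:R *: colsub f y \is a mxOver Num.int.
      by apply/mxOverP => i j; move/mxOverP/(_ i (f j)): Ny; rewrite !mxE.
    have [c' c'E] := word_pt_surj N_gt0 Ny.
    have [c cE] := word_pt_surj N_gt0 Nfy.
    rewrite -(code_of_frac CG) -(code_of_frac CG') -c'E -cE.
    by rewrite -(code_of_word CG) -(code_of_word CG'); apply: words.
  split=> Gy; apply/G_iff => //; last exact: code_of_int CG' Gy.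
  apply/mxOverP => i j; have /mxOverP/(_ i (g j)) := code_of_int CG Gy.
  by rewrite !mxE gK.
have [g fK gK] := fbij.
have NN' : N = N'.
  suff dvdE M : (N %| M)%N <-> (N' %| M)%N.
    by apply/eqP; rewrite eqn_dvd; apply/andP; split; [apply/dvdE|apply/dvdE].
  rewrite (code_of_dvd CG) (code_of_dvd CG'); split=> MG x Gx.
    have := MG _ ((fP x).2 Gx) => /mxOverP xi; apply/mxOverP => i j.
    by have := xi i (g j); rewrite !mxE gK.
  have xE : colsub f (colsub g x) = x by apply/rowP => i; rewrite !mxE fK.
  have /mxOverP xi := MG (colsub g x) ((fP _).1 (eq_ind_r G Gx xE)).
  by apply/mxOverP => i j; have := xi i (f j); rewrite !mxE fK.
subst N'; split=> //; exists f => // c c' cc'.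
rewrite (code_of_word CG) (code_of_word CG') -fP.
suff -> : word_pt c = colsub f (word_pt c') by [].
by apply/rowP => i; rewrite !mxE cc'.
Qed.

End Codes.

Section FreeJoin.
Variables (R : realType).

Definition join_vertex k m l n (p : 'I_k -> 'rV[int]_m) (q : 'I_l -> 'rV[int]_n)
    (i : 'I_(k + l)) : 'rV[int]_(m + n + 1) :=
  match split i with
  | inl a => row_mx (row_mx (p a) 0) 0
  | inr b => row_mx (row_mx 0 (q b)) (const_mx 1)
  end.

Lemma join_vertexl k m l n (p : 'I_k -> 'rV[int]_m) (q : 'I_l -> 'rV[int]_n) a :
  lattice_pt R (join_vertex p q (lshift l a)) =
  row_mx (row_mx (lattice_pt R (p a)) 0) 0.
Proof.
by rewrite /join_vertex (unsplitK (inl _ a)) /lattice_pt !map_row_mx !map_mx0.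
Qed.

Lemma join_vertexr k m l n (p : 'I_k -> 'rV[int]_m) (q : 'I_l -> 'rV[int]_n) b :
  lattice_pt R (join_vertex p q (rshift k b)) =
  row_mx (row_mx 0 (lattice_pt R (q b))) (const_mx 1).
Proof.
rewrite /join_vertex (unsplitK (inr _ b)) /lattice_pt !map_row_mx !map_mx0.
by rewrite map_const_mx.
Qed.

Lemma sum_join_vertex k m l n (p : 'I_k -> 'rV[int]_m) (q : 'I_l -> 'rV[int]_n)
    (c : 'I_(k + l) -> R) :
  \sum_i c i *: lattice_pt R (join_vertex p q i) =
  row_mx (row_mx (\sum_a c (lshift l a) *: lattice_pt R (p a))
                 (\sum_b c (rshift k b) *: lattice_pt R (q b)))
         (const_mx (\sum_b c (rshift k b))).
Proof.
rewrite big_split_ord /=.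
under eq_bigr do rewrite join_vertexl !scale_row_mx !scaler0.
under [X in _ + X]eq_bigr do
  rewrite join_vertexr !scale_row_mx scaler0 scalemx_const mulr1.
apply/rowP => j; rewrite mxE !summxE; case: (split_ordP j) => {}j ->.
  case: (split_ordP j) => {}j ->; rewrite !row_mxEl ?row_mxEr !summxE.
    under eq_bigr do rewrite !row_mxEl.
    by under [X in _ + X]eq_bigr do rewrite !row_mxEl mxE; rewrite big1_eq addr0.
  under eq_bigr do rewrite row_mxEl row_mxEr mxE.
  by under [X in _ + X]eq_bigr do rewrite row_mxEl row_mxEr; rewrite big1_eq add0r.
rewrite row_mxEr mxE; under [X in X + _]eq_bigr do rewrite row_mxEr mxE.
by under [X in _ + X]eq_bigr do rewrite row_mxEr mxE; rewrite big1_eq add0r.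
Qed.

Lemma join_vertex_indep k m l n (p : 'I_k -> 'rV[int]_m) (q : 'I_l -> 'rV[int]_n) :
  affinely_independent (fun i => lattice_pt R (p i)) ->
  affinely_independent (fun i => lattice_pt R (q i)) ->
  affinely_independent (fun i => lattice_pt R (join_vertex p q i)).
Proof.
move=> ip iq c c0; rewrite sum_join_vertex -row_mx0 -row_mx0.
move=> /eq_row_mx[/eq_row_mx[cp cq] /rowP/(_ 0)]; rewrite !mxE => cr0.
move: c0; rewrite big_split_ord /= cr0 addr0 => cl0 i.
case: (split_ordP i) => {}i ->.
  exact: (ip (fun a => c (lshift l a))).
exact: (iq (fun b => c (rshift k b))).
Qed.

Lemma dual_group_join k m l n (p : 'I_k -> 'rV[int]_m) (q : 'I_l -> 'rV[int]_n)
    (x : 'rV[R]_(k + l)) :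
  dual_group (join_vertex p q) x <->
  group_prod (dual_group p) (dual_group q) x.
Proof.
rewrite /group_prod /dual_group /= !mul_homogenization sum_join_vertex.
rewrite big_split_ord /=.
have -> : \sum_i lsubmx x 0 i = \sum_i x 0 (lshift l i).
  by apply: eq_bigr => i _; rewrite mxE.
have -> : \sum_i rsubmx x 0 i = \sum_i x 0 (rshift k i).
  by apply: eq_bigr => i _; rewrite mxE.
have -> : \sum_i lsubmx x 0 i *: lattice_pt R (p i) =
    \sum_i x 0 (lshift l i) *: lattice_pt R (p i).
  by apply: eq_bigr => i _; rewrite mxE.
have -> : \sum_i rsubmx x 0 i *: lattice_pt R (q i) =
    \sum_i x 0 (rshift k i) *: lattice_pt R (q i).
  by apply: eq_bigr => i _; rewrite mxE.
set X := \sum_i x 0 (lshift l i) *: _; set Y := \sum_i x 0 (rshift k i) *: _.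
set s := \sum_i x 0 (lshift l i); set t := \sum_i x 0 (rshift k i).
have const_int (u : R) :
    (const_mx u : 'rV_1) \is a mxOver Num.int <-> u \is a Num.int.
  by rewrite mxOver_constE.
rewrite !mxOver_int_row_mx !const_int; split=> [[[[XI YI] tI] stI]|[[XI sI] [YI tI]]].
  by do !split => //; rewrite -[s](addrK t) rpredB.
by do !split => //; rewrite rpredD.
Qed.

Lemma free_join_convex_comb k m l n (p : 'I_k -> 'rV[int]_m)
    (q : 'I_l -> 'rV[int]_n) :
  free_join (convex_comb (fun i => lattice_pt R (p i)))
            (convex_comb (fun i => lattice_pt R (q i))) =
  convex_comb (fun i => lattice_pt R (join_vertex p q i)).
Proof.
have splitl j : split (lshift l j) = inl j := unsplitK (inl j).
have splitr j : split (rshift k j) = inr j := unsplitK (inr j).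
rewrite eqEsubset; split.
  apply: conv_hull_min; first exact: convex_comb_convex.
  move=> _ [[_ [a [a0 a1 ->]] <-]|[_ [b [b0 b1 ->]] <-]].
    exists (fun i => match split i with inl j => a j | inr _ => 0 end).
    rewrite big_split_ord sum_join_vertex /=.
    under eq_bigr do rewrite splitl.
    under [X in _ + X]eq_bigr do rewrite splitr.
    split=> [i||]; first by case: split.
      by rewrite a1 big1_eq addr0.
    congr row_mx.
      congr row_mx; first by apply: eq_bigr => i _; rewrite splitl.
      by rewrite big1 // => i _; rewrite splitr scale0r.
    by rewrite big1 // => i _; rewrite splitr.
  exists (fun i => match split i with inl _ => 0 | inr j => b j end).
  rewrite big_split_ord sum_join_vertex /=.
  under eq_bigr do rewrite splitl.
  under [X in _ + X]eq_bigr do rewrite splitr.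
  split=> [i||]; first by case: split.
    by rewrite b1 big1_eq add0r.
  congr row_mx.
    congr row_mx; last by apply: eq_bigr => i _; rewrite splitr.
    by rewrite big1 // => i _; rewrite splitl scale0r.
  by congr const_mx; rewrite -b1; apply: eq_bigr => i _; rewrite splitr.
move=> x jx A [cA]; rewrite subUset => -[A1 A2].
apply: (convex_set_comb cA _ jx) => i; case: (split_ordP i) => {}i ->.
  rewrite join_vertexl; apply: A1; exists (lattice_pt R (p i)) => //.
  exact: (convex_comb_pt (fun i => lattice_pt R (p i))).
rewrite join_vertexr; apply: A2; exists (lattice_pt R (q i)) => //.
exact: (convex_comb_pt (fun i => lattice_pt R (q i))).
Qed.

Lemma affinely_independent_reindex (V : lmodType R) k l (p : 'I_k -> V)
    (f : 'I_l -> 'I_k) :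
  bijective f -> affinely_independent p ->
  affinely_independent (fun i => p (f i)).
Proof.
move=> [g fK gK] ip c c0 cp i; rewrite -(fK i).
have gbij : bijective g by exists f.
apply: (ip (c \o g)).
  by apply: etrans c0; rewrite [RHS](reindex g) //; exact: onW_bij.
apply: etrans cp; rewrite [RHS](reindex g) /=; last exact: onW_bij.
by apply: eq_bigr => j _; rewrite gK.
Qed.

Lemma convex_comb_reindex (V : lmodType R) k l (p : 'I_k -> V)
    (f : 'I_l -> 'I_k) :
  bijective f -> convex_comb (fun i => p (f i)) = convex_comb p.
Proof.
move=> [g _ gK]; rewrite -!conv_hull_range; congr conv_hull.
rewrite eqEsubset; split=> _ [i _ <-]; first by exists (f i).
by exists (g i); rewrite ?gK.
Qed.

Lemma lattice_iso_dual_group k m l n (p : 'I_k -> 'rV[int]_m)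
    (q : 'I_l -> 'rV[int]_n) :
  k = (m + 1)%N -> l = (n + 1)%N ->
  affinely_independent (fun i => lattice_pt R (p i)) ->
  affinely_independent (fun i => lattice_pt R (q i)) ->
  lattice_iso (convex_comb (fun i => lattice_pt R (p i)))
              (convex_comb (fun i => lattice_pt R (q i))) <->
  exists2 f : 'I_k -> 'I_l, bijective f &
    forall y : 'rV[R]_l, dual_group p (colsub f y) <-> dual_group q y.
Proof.
move=> km ln ip iq; split=> [[U [U' [t [UU' U'U pq]]]]|[f fbij fP]].
  have Uinj : injective (mulmxr (map_mx intr U) : 'rV[R]_m -> 'rV[R]_n).
    apply: (can_inj (g := mulmxr (map_mx intr U'))) => x /=.
    by rewrite -mulmxA -map_mxM UU' map_mx1 mulmx1.
  have imE := convex_comb_affine_image (fun i => lattice_pt R (p i))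
    (mulmxr (map_mx intr U)) (lattice_pt R t).
  have [f fbij fE] := convex_comb_bij
    (affinely_independent_affine (t := lattice_pt R t) Uinj ip) iq
    (etrans (esym imE) pq).
  exists f => // y; rewrite -(dual_group_reindex q y fbij).
  have qE i : q (f i) = p i *m U + t.
    by apply: (@map_intr_inj R); rewrite map_mxD map_mxM; apply: fE.
  have pE i : p i = q (f i) *m U' + - (t *m U').
    by rewrite qE mulmxDl -mulmxA UU' mulmx1 addrK.
  split; first exact: (dual_group_affine (q := q \o f) qE).
  exact: (dual_group_affine (p := q \o f) pE).
have iqf := affinely_independent_reindex fbij iq.
have kl : k = l by rewrite -(card_ord k) -(card_ord l); apply: bij_eq_card fbij.
have dual_eq : @dual_group R _ _ p = dual_group (q \o f).
  have [g fK gK] := fbij.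
  apply/seteqP; split=> x; have -> : x = colsub f (colsub g x).
  - by apply/rowP => i; rewrite !mxE fK.
  - by move/fP; rewrite dual_group_reindex.
  - by apply/rowP => i; rewrite !mxE fK.
  - by rewrite dual_group_reindex // => /fP.
have [|||| U [U' [t [UU' U'U qE]]]] := dual_group_eq_affine _ _ _ _ dual_eq.
- exact: homogenization_free.
- exact: homogenization_full.
- exact: homogenization_free.
- by apply: homogenization_full => //; rewrite kl.
exists U, U', t; split=> //.
have imE := convex_comb_affine_image (fun i => lattice_pt R (p i))
  (mulmxr (map_mx intr U)) (lattice_pt R t).
apply: (etrans imE); rewrite -(convex_comb_reindex _ fbij); congr convex_comb.
by apply/funext => i /=; rewrite -[q (f i)]/((q \o f) i) qE /lattice_pt map_mxD map_mxM.
Qed.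

End FreeJoin.

Theorem lemma2p9 (R : realType) (d d1 d2 : nat)
    (D : lattice_simplex R d)
    (D1 : lattice_simplex R d1) (D2 : lattice_simplex R d2) :
  lattice_iso (polytope D) (free_join (polytope D1) (polytope D2)) <->
  code_iso (simplex_code D) (direct_sum (simplex_code D1) (simplex_code D2)).
Proof.
rewrite /polytope !conv_hull_range free_join_convex_comb.
rewrite (code_iso_groups (simplex_code_of D)
  (direct_sum_code_of (simplex_code_of D1) (simplex_code_of D2))).
rewrite lattice_iso_dual_group ?addn1 //; first last.
- by apply: join_vertex_indep; apply: vertex_indep.
- exact: vertex_indep.
- by rewrite addSn addnS.
by split=> -[f fbij fP]; exists f => // y; rewrite fP dual_group_join.
Qed.
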